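(* Let $\tau$ be a rooted tree, let $\mathcal R_\tau=\{b(v):v\in\tau\}$ be the multiset of branch numbers and $\mathcal D_\tau=\{d(v):v\in\tau\}$ the multiset of distance numbers. Then $\mathcal R_\tau$ majorizes $\mathcal D_\tau$.
   Context: A rooted tree $\tau$ is a finite tree with a distinguished root vertex $R$. For a vertex $v$, $b(v)$ is the number of vertices $w$ (including $v$) such that $v$ lies on the path from $w$ to $R$; $d(v)$ is the number of vertices on the shortest path from $v$ to $R$, including both endpoints. Majorization: for two multisets $\mathcal A,\mathcal B$ of $n$ real numbers, let $a_1\ge\dots\ge a_n$ and $b_1\ge\dots\ge b_n$ be their elements in non-increasing order. $\mathcal A$ majorizes $\mathcal B$ if $a_1+\dots+a_k\ge b_1+\dots+b_k$ for all $1\le k<n$ and $a_1+\dots+a_n=b_1+\dots+b_n$. *)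

(* Defs.v *)
From mathcomp Require Import all_boot all_order all_algebra.
From mathcomp Require Import finmap multiset reals.

Set Implicit Arguments.
Unset Strict Implicit.
Unset Printing Implicit Defensive.

Import Order.TTheory GRing.Theory Num.Theory.
Local Open Scope ring_scope.

(* A duplicate-free cycle of length 2 merely goes back and forth along an
   edge, so acyclicity only excludes duplicate-free cycles of length >= 3. *)
Definition is_tree (T : finType) (e : rel T) : Prop :=
  [/\ symmetric e, irreflexive e, (forall x y, connect e x y)
    & forall c : seq T, ucycle e c -> (size c < 3)%N].

(* x :: p is a path, without repeated vertices, from x to y. *)
Definition is_path (T : finType) (e : rel T) (x y : T) (p : seq T) : bool :=
  [&& path e x p, uniq (x :: p) & last x p == y].

(* Paths are duplicate-free, so those of size at most #|T| are all of them. *)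
Definition on_path (T : finType) (e : rel T) (v w r : T) : bool :=
  [exists p : #|T|.-bseq T, is_path e w r p && (v \in w :: p)].

Definition branch_number (T : finType) (e : rel T) (r v : T) : nat :=
  #|[set w | on_path e v w r]|.

(* The default value #|T| bounds the number of vertices of any path, hence it
   is irrelevant as soon as there is a path from v to r. *)
Definition distance_number (T : finType) (e : rel T) (r v : T) : nat :=
  \big[minn/#|T|]_(p : #|T|.-bseq T | is_path e v r p) size (v :: p).

Definition branch_multiset (R : realType) (T : finType) (e : rel T) (r : T) :
    {mset R}%mset :=
  seq_mset [seq (branch_number e r v)%:R | v : T].

Definition distance_multiset (R : realType) (T : finType) (e : rel T) (r : T) :
    {mset R}%mset :=
  seq_mset [seq (distance_number e r v)%:R | v : T].

Definition majorizes (R : realType) (A B : {mset R}%mset) : Prop :=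
  let n := size A in
  let a := sort (fun x y : R => y <= x) A in
  let b := sort (fun x y : R => y <= x) B in
  [/\ size B = n,
      forall k : nat, (1 <= k < n)%N ->
        \sum_(i < k) b`_i <= \sum_(i < k) a`_i
    & \sum_(i < n) a`_i = \sum_(i < n) b`_i].

Lemma size_is_path (T : finType) (e : rel T) (x y : T) (p : seq T) :
  is_path e x y p -> (size p < #|T|)%N.
Proof. by case/and3P=> _ /card_uniqP + _ => /= <-; apply: max_card. Qed.

Lemma on_pathP (T : finType) (e : rel T) (v w r : T) :
  reflect (exists2 p : seq T, is_path e w r p & v \in w :: p)
          (on_path e v w r).
Proof.
apply: (iffP existsP) => [[p /andP[]]|[p pP vp]]; first by exists p.
by exists (Bseq (ltnW (size_is_path pP))); apply/andP.
Qed.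

Lemma distance_number_le (T : finType) (e : rel T) (r v : T) (p : seq T) :
  is_path e v r p -> (distance_number e r v <= size (v :: p))%N.
Proof.
move=> pP; rewrite /distance_number.
pose q : #|T|.-bseq T := Bseq (ltnW (size_is_path pP)).
have := mem_index_enum q; elim: (index_enum _) => // q' s IHs.
rewrite in_cons big_cons => /predU1P[<-|/IHs le_s]; first by rewrite pP geq_minl.
by case: ifP => // _; rewrite geq_min le_s orbT.
Qed.

Lemma distance_number_path (T : finType) (e : rel T) (r v : T) :
  connect e v r ->
  exists2 p : seq T, is_path e v r p & distance_number e r v = size (v :: p).
Proof.
case/connectP=> p0 /shortenP[p ep up _] rp.
have pP : is_path e v r p by rewrite /is_path ep up -rp eqxx.
suff [//|E] : (exists2 q : seq T, is_path e v r q
                 & distance_number e r v = size (v :: q))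
              \/ distance_number e r v = #|T|.
  exists p => //; apply/eqP; rewrite eqn_leq distance_number_le // E.
  exact: size_is_path pP.
rewrite /distance_number; elim/big_ind: _ => [|m n Hm Hn|q qP]; first by right.
  by rewrite /minn; case: ifP.
by left; exists q.
Qed.

(* Main.v *)
Require Import Defs.
From mathcomp Require Import all_boot all_order all_algebra.
From mathcomp Require Import finmap multiset reals.
From mathcomp Require Import zify.

(** For multisets with equal sums, majorization follows from the inequalities
    [sum (d - t)^+ <= sum (b - t)^+] for all thresholds [t].  Here
    [sum_v (d(v) - t)^+] counts the pairs (ancestor u, vertex v) at distance at
    least [t].  Fix [u]: if it has a descendant at distance at least [t], then
    the path from that descendant to [u] contains [t] descendants of [u] at
    distance less than [t], so at most [(b(u) - t)^+] pairs involve [u]. *)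

Set Implicit Arguments.
Unset Strict Implicit.
Unset Printing Implicit Defensive.

Import Order.TTheory GRing.Theory Num.Theory.

Section TreePaths.
Variables (T : finType) (e : rel T).

Lemma is_path_cons (x a y : T) (p : seq T) :
  is_path e x y (a :: p) -> is_path e a y p.
Proof. by rewrite /is_path /= => /and3P[/andP[_ ->] /andP[_ ->] ->]. Qed.

Lemma is_path_drop (x y : T) (p : seq T) (j : nat) :
  is_path e x y p -> j <= size p -> is_path e (nth x (x :: p) j) y (drop j p).
Proof.
elim: p x j => [|a p IHp] x [|j] // xp lejp.
rewrite [nth _ _ _]/= (set_nth_default a) //.
by apply: IHp lejp; apply: is_path_cons xp.
Qed.

(** If two paths leave [x] through distinct neighbours [a] and [b], their tails connect [a] to [b]
    while avoiding [x]; closing such a connection through [x] gives a forbidden cycle. *)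
Lemma is_path_uniq (x y : T) (p q : seq T) :
  is_tree e -> is_path e x y p -> is_path e x y q -> p = q.
Proof.
case=> symE _ _ acyc; elim: p x q => [|a p IHp] x [|b q] //=.
- case/and3P=> _ _ /= /eqP xy /and3P[_ /= /andP[+ _] /eqP lq].
  by rewrite xy -lq mem_last.
- move=> + /and3P[_ _ /= /eqP xy] => /and3P[_ /= /andP[+ _] /eqP lp].
  by rewrite xy -lp mem_last.
move=> xp xq; case: (eqVneq a b) => [ab|neq_ab].
  rewrite -ab in xq *; congr cons.
  exact: IHp (is_path_cons xp) (is_path_cons xq).
pose e' := [rel u v | [&& e u v, u != x & v != x]].
have symE' : connect_sym e'.
  by apply: sym_connect_sym => u v /=; rewrite symE andbCA andbC -andbA andbCA.
have conn c s : is_path e x y (c :: s) -> connect e' c y.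
  case/and3P=> /= /andP[_ cs] /andP[xNcs _] /eqP <-.
  apply/connectP; exists s => //.
  apply: (sub_in_path (P := predC1 x)) cs => [u v ux vx euv|].
    by apply/and3P.
  by apply/allP=> z zs /=; apply: contraNneq xNcs => <-.
have : connect e' a b.
  by apply: connect_trans (conn _ _ xp) _; rewrite symE'; apply: conn xq.
case/connectP=> s0 /shortenP[s as_ us _] bs.
case/and3P: xp => /= /andP[exa _] /andP[xNap _] _.
case/and3P: xq => /= /andP[exb _] _ _.
have xs : x \notin a :: s.
  rewrite inE negb_or; apply/andP; split.
    by apply: contraNneq xNap => ->; rewrite mem_head.
  elim: (s) (a) as_ => //= z s' IHs a' /andP[/and3P[_ _ zx] /IHs xs'].
  by rewrite inE negb_or eq_sym zx.
have es : path e a s by apply: sub_path as_ => u v /and3P[].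
(* This cycle has at least 3 vertices unless [s] is empty, which would force [a = b]. *)
suff /acyc : ucycle e [:: x, a & s].
  by case: (s) bs => // ab; rewrite ab eqxx in neq_ab.
by rewrite /ucycle /ucycleb /cycle /= exa rcons_path es -bs symE exb /= xs.
Qed.

End TreePaths.

Lemma mem_drop_index (T : eqType) (s : seq T) (n : nat) (x : T) :
  uniq s -> (x \in drop n s) = (x \in s) && (n <= index x s).
Proof.
move=> us; case: (boolP (x \in s)) => [xs|]; last first.
  by apply: contraNF; apply: mem_drop.
rewrite leqNgt -(in_take n xs).
move: us xs; rewrite -{1 2}(cat_take_drop n s) cat_uniq mem_cat.
case/and3P=> _ /hasPn nts _.
case: (boolP (x \in drop n s)) => [/nts /negPf /= ->//|].
by rewrite orbF => _ ->.
Qed.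

Section Chains.
(** In the application [P v] lists the vertices from [v] up to the root, so [drop t (P v)] holds the
    ancestors of [v] at distance at least [t]. *)
Variables (T : finType) (P : T -> seq T).
Hypothesis uniqP : forall v, uniq (P v).

(** Double counting of the pairs [(u, v)] with [u] in [drop t (P v)]. *)
Lemma sum_size_subn (t : nat) :
  \sum_v (size (P v) - t) = \sum_u #|[pred v | u \in drop t (P v)]|.
Proof.
transitivity (\sum_v \sum_u (u \in drop t (P v) : nat)).
  apply: eq_bigr => v _; rewrite -size_drop.
  have /card_uniqP <- := drop_uniq t (uniqP v).
  by rewrite -sum1_card big_mkcond.
rewrite exchange_big; apply: eq_bigr => u _.
rewrite -sum1_card [RHS]big_mkcond.
by apply: eq_bigr => v _; rewrite inE; case: ifP.
Qed.

Hypothesis dropP :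
  forall v j, j < size (P v) -> P (nth v (P v) j) = drop j (P v).

Lemma card_far_le (u : T) (t : nat) :
  #|[pred v | u \in drop t (P v)]| <= #|[set v | u \in P v]| - t.
Proof.
case: (pickP [pred v | u \in drop t (P v)]) => [v /= ut|none]; last first.
  by rewrite (eq_card0 none).
move: ut; rewrite mem_drop_index //; set i := index u (P v) => /andP[uv leti].
have lti : i < size (P v) by rewrite index_mem.
(* [W] occupies the positions [i - t + 1] to [i] of [P v]: the last [t] vertices up to [u], with [u]
   included. *)
pose W := take t (drop (i - t).+1 (P v)).
have sizeW : size W = t by rewrite size_take_min size_drop; lia.
set F := [pred v | _]; set B := [set v | _].
have FB : [set v in F] \subset B.
  by apply/subsetP=> w; rewrite !inE => /mem_drop.
have WBF : [set w in W] \subset B :\: [set v in F].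
  apply/subsetP=> w; rewrite !inE => /(nthP v)[k]; rewrite sizeW => ltk.
  (* The chain of the [k]-th vertex of [W] is a tail of [P v] in which [u] has position [t - 1 - k],
     hence less than [t]. *)
  rewrite nth_take // nth_drop => <-; rewrite dropP; last by lia.
  rewrite drop_drop !mem_drop_index // uv -/i /= -ltnNge; lia.
have cardF : #|[set v in F]| = #|F| by rewrite cardsE.
have cardW : #|[set w in W]| = t.
  rewrite cardsE -[RHS]sizeW; apply/card_uniqP.
  by rewrite take_uniq // drop_uniq.
move: (subset_leq_card WBF) (subset_leq_card FB).
by rewrite cardsDS // cardW cardF; lia.
Qed.

Lemma sum_size_subn_le (t : nat) :
  \sum_v (size (P v) - t) <= \sum_u (#|[set v | u \in P v]| - t).
Proof. by rewrite sum_size_subn; apply: leq_sum => u _; apply: card_far_le. Qed.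

Lemma sum_size : \sum_v size (P v) = \sum_u #|[set v | u \in P v]|.
Proof.
transitivity (\sum_v (size (P v) - 0)).
  by under [RHS]eq_bigr do rewrite subn0.
rewrite sum_size_subn; apply: eq_bigr => u _.
by rewrite cardsE; apply: eq_card => v; rewrite !inE drop0.
Qed.

End Chains.

Local Open Scope ring_scope.

(** For [c] the [k]-th largest element of [A], the positive parts of [x - c] over [A] sum to exactly
    the first [k] differences, while over [B] they bound any [k] differences from above. Thresholds
    range over [A] only, so that they are natural numbers in the application. *)
Lemma majorizes_threshold (R : realType) (A B : {mset R}%mset) :
    size B = size A -> \sum_(x <- A) x = \sum_(x <- B) x ->
    {in A, forall c, \sum_(x <- B) Num.max 0 (x - c)
                     <= \sum_(x <- A) Num.max 0 (x - c)} ->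
  majorizes A B.
Proof.
move=> sizeAB sumAB thr; rewrite /majorizes.
set ge := fun x y : R => y <= x.
have pA : perm_eq (sort ge A) A by rewrite perm_sort.
have pB : perm_eq (sort ge B) B by rewrite perm_sort.
have sA : sorted ge (sort ge A).
  by apply: sort_sorted => x y; apply: le_total.
move: pA pB sA; set a := sort ge A; set b := sort ge B => pA pB sA.
have sza : size a = size A := perm_size pA.
have szb : size b = size A by rewrite (perm_size pB).
have sumE (F : R -> R) s :
    size s = size A -> \sum_(x <- s) F x = \sum_(i < size A) F s`_i.
  by move=> <-; rewrite (big_nth 0) big_mkord.
split=> // [k /andP[k0 kn]|]; last first.
  by rewrite -(sumE id a) // -(sumE id b) // (perm_big _ pA) (perm_big _ pB).
(* With this threshold all positive parts of [a] lie among its first [k] terms. *)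
pose c := a`_k.-1.
have cA : c \in A by rewrite -(perm_mem pA) mem_nth // sza; lia.
have geA i j : (i <= j < size A)%N -> a`_j <= a`_i.
  case/andP=> leij ltj; apply: (sorted_leq_nth _ _ 0 sA) => //.
  - by move=> y x z; rewrite /ge => yx zy; apply: le_trans zy yx.
  - by move=> x; apply: lexx.
  - by rewrite inE sza; lia.
  - by rewrite inE sza.
have splitc (s : seq R) : \sum_(i < k) s`_i = \sum_(i < k) (s`_i - c) + c *+ k.
  by rewrite sumrB sumr_const card_ord subrK.
rewrite !splitc lerD2r.
have ubB : \sum_(i < k) (b`_i - c) <= \sum_(x <- B) Num.max 0 (x - c).
  rewrite -(perm_big _ pB) sumE //.
  rewrite (big_ord_widen _ (fun i => b`_i - c) (ltnW kn)) big_mkcond.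
  by apply: ler_sum => i _; case: ifP => _; rewrite le_max lexx ?orbT.
apply: le_trans ubB (le_trans (thr c cA) _).
rewrite -(perm_big _ pA) sumE //.
rewrite (big_ord_widen _ (fun i => a`_i - c) (ltnW kn)) [leRHS]big_mkcond.
(* For [i < k] the difference is nonnegative and equals its positive part; for the other [i] the
   positive part is 0. *)
apply: ler_sum => i _; rewrite ge_max; case: ifP => ik.
  by rewrite lexx subr_ge0 geA //; lia.
by rewrite lexx subr_le0 geA //; case: i ik => /=; lia.
Qed.

Lemma max0_natB (R : realDomainType) (m n : nat) :
  Num.max 0 (m%:R - n%:R) = (m - n)%:R :> R.
Proof.
case: (leqP n m) => [lenm|/ltnW lemn].
  by rewrite natrB // max_r // subr_ge0 ler_nat.
by rewrite (eqP lemn) max_l // subr_le0 ler_nat.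
Qed.

Theorem theorem3p5 (R : realType) (T : finType) (e : rel T) (r : T)
    (tree_e : is_tree e) :
  majorizes (branch_multiset R e r) (distance_multiset R e r).
Proof.
have conn v : connect e v r by case: tree_e.
have /fin_all_exists[p pP] v : exists p, is_path e v r p
    /\ distance_number e r v = size (v :: p).
  by have [p vp dv] := distance_number_path (conn v); exists p.
pose P v := v :: p v.
have uniqP v : uniq (P v) by case: (pP v) => /and3P[].
have dropP v j : (j < size (P v))%N -> P (nth v (P v) j) = drop j (P v).
  rewrite ltnS => lej; have [vp _] := pP v.
  (* The tail of a chosen path is a path to [r], so by uniqueness it is the path chosen for its
     first vertex. *)
  have pE := is_path_uniq tree_e (pP _).1 (is_path_drop vp lej).
  by rewrite [RHS](drop_nth v) // {1}/P pE.
have dE v : distance_number e r v = size (P v) by case: (pP v).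
have bE u : branch_number e r u = #|[set v | u \in P v]|.
  apply: eq_card => v; rewrite !inE; have [vp _] := pP v.
  apply/on_pathP/idP => [[q vq]|uP]; last by exists (p v).
  by rewrite (is_path_uniq tree_e vq vp).
have pB := perm_eq_seq_mset [seq ((branch_number e r v)%:R : R) | v : T].
have pD := perm_eq_seq_mset [seq ((distance_number e r v)%:R : R) | v : T].
apply: majorizes_threshold.
- by rewrite (perm_size pB) (perm_size pD) !size_map.
- rewrite (perm_big _ pB) (perm_big _ pD) !big_image /= -!natr_sum; congr _%:R.
  under eq_bigr do rewrite bE; under [RHS]eq_bigr do rewrite dE.
  by rewrite sum_size.
(* The threshold is a branch number, so positive parts become truncated subtractions in [nat]. *)
move=> c; rewrite (perm_mem pB) => /mapP[w _ ->].
set t := branch_number e r w.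
rewrite (perm_big _ pB) (perm_big _ pD) !big_image /=.
under eq_bigr do rewrite max0_natB dE.
under [leRHS]eq_bigr do rewrite max0_natB bE.
by rewrite -!natr_sum ler_nat; apply: sum_size_subn_le.
Qed.
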